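(* Let $m\ge 2$ be an integer. (i) For every $0\le s\le\lfloor m/2\rfloor$, the subdigraph $\langle S_m^{(s)}\rangle_{\mathcal{D}^*_m}$ of $\mathcal{D}^*_m$ induced by $S_m^{(s)}$ is strongly connected. (ii) For every $1\le s\le\lfloor m/2\rfloor$, $\langle S_m^{(s)}\rangle_{\mathcal{D}^*_m}$ is a bipartite digraph with classes $R_m^{(s)}$ and $G_m^{(s)}$. (iii) There is no arc joining a vertex of $S_m^{(s)}$ to a vertex of $S_m^{(t)}$ for $0\le s<t\le\lfloor m/2\rfloor$, i.e. $\mathcal{D}^*_m=\bigcup_{s=0}^{\lfloor m/2\rfloor}\langle S_m^{(s)}\rangle_{\mathcal{D}^*_m}$.
   Context: Code letters. Each letter of the alphabet $\{a,b,c,d,e,f\}$ encodes a 2-element subset of the four directions $\{\text{up},\text{down},\text{left},\text{right}\}$ (the two edges of a 2-factor used at a grid vertex): $a=\{\text{right},\text{down}\}$, $b=\{\text{up},\text{down}\}$, $c=\{\text{up},\text{right}\}$, $d=\{\text{left},\text{down}\}$, $e=\{\text{left},\text{right}\}$, $f=\{\text{up},\text{left}\}$. Digraph $\mathcal{D}_m$ ($m\ge1$). Its vertices (alpha-words) are the words $\alpha_1\alpha_2\cdots\alpha_m$ over $\{a,b,c,d,e,f\}$ (read as a column from top to bottom) such that: $\alpha_1\in\{a,d,e\}$ (does not contain up), $\alpha_m\in\{c,e,f\}$ (does not contain down), and for $1\le i\le m-1$, $\alpha_i$ contains down if and only if $\alpha_{i+1}$ contains up. There is an arc from $\alpha_1\cdots\alpha_m$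 to $\beta_1\cdots\beta_m$ if and only if for every $i$, $\alpha_i$ contains right if and only if $\beta_i$ contains left. Outlet word. For an alpha-word $\alpha$, its outlet word $o(\alpha)=o_1\cdots o_m\in\{0,1\}^m$ has $o_j=1$ if $\alpha_j\in\{a,c,e\}$ (contains right) and $o_j=0$ if $\alpha_j\in\{b,d,f\}$. Digraph $\mathcal{D}^*_m$. It is obtained from $\mathcal{D}_m$ by gluing all vertices having the same outlet word: its vertices are the binary words $o(\alpha)$, $\alpha\in V(\mathcal{D}_m)$, and there is a (single) arc $v\to w$ if and only if there are $\alpha,\beta\in V(\mathcal{D}_m)$ with $o(\alpha)=v$, $o(\beta)=w$ and an arc from $\alpha$ to $\beta$ in $\mathcal{D}_m$. Loops are allowed. The arc relation is known to be symmetric ($v\to w$ iff $w\to v$). It is also known that $V(\mathcal{D}^*_m)=\{0,1\}^m$ for $m$ even, and $V(\mathcal{D}^*_m)=\{0,1\}^m\setminus\{(01)^k0\}$ for $m=2k+1$. Sets of words. For a binary word $x$ of length $m$ (positions numbered $1,\dots,m$), $odd(x)$ and $even(x)$ are the numbers of 0's of $x$ at odd and at even positions, and $Z(x)=odd(x)-even(x)$. Set $S_m^{(0)}=\{x\in\{0,1\}^m: Z(x)=0\}$ and, for $1\le s\le\lfloor m/2\rfloor$, $R_m^{(s)}=\{x\in\{0,1\}^m: Z(x)=s\}$, $G_m^{(s)}=\{x\in\{0,1\}^m: Z(x)=-s\}$, $S_m^{(s)}=R_m^{(s)}\cup G_m^{(s)}$. The union of the sets $S_m^{(s)}$, $0\le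 s\le\lfloor m/2\rfloor$, is $V(\mathcal{D}^*_m)$. A digraph is bipartite with classes $R$ and $G$ if $R,G$ partition its vertex set and no arc joins two vertices (possibly equal) of the same class. *)

(* Defs.v *)
From HB Require Import structures.
From mathcomp Require Import all_boot all_order all_algebra.

Set Implicit Arguments.
Unset Strict Implicit.
Unset Printing Implicit Defensive.

Import GRing.Theory.

Record digraph (T : finType) : Type :=
  Digraph { verts : {set T}; arcs : {set T * T} }.

(* Intended for S \subset verts G. *)
Definition induced (T : finType) (G : digraph T) (S : {set T}) : digraph T :=
  Digraph S [set p in arcs G | (p.1 \in S) && (p.2 \in S)].

Definition digraph0 (T : finType) : digraph T := Digraph set0 set0.

Definition digraphU (T : finType) (G H : digraph T) : digraph T :=
  Digraph (verts G :|: verts H) (arcs G :|: arcs H).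

(* Gluing all vertices of G that have the same image under f. *)
Definition glue (T U : finType) (f : T -> U) (G : digraph T) : digraph U :=
  Digraph [set f x | x in verts G] [set (f p.1, f p.2) | p in arcs G].

Definition strongly_connected (T : finType) (G : digraph T) : Prop :=
  forall x y : T, x \in verts G -> y \in verts G ->
    connect [rel u v | (u, v) \in arcs G] x y.

Definition bipartite_with (T : finType) (G : digraph T) (A B : {set T}) : Prop :=
  [/\ verts G = A :|: B,
      [disjoint A & B] &
      forall x y : T, (x, y) \in arcs G ->
        ~~ ((x \in A) && (y \in A)) /\ ~~ ((x \in B) && (y \in B))].

Inductive direction : Type := Up | Down | Left | Right.

Inductive letter : Type := La | Lb | Lc | Ld | Le | Lf.

Definition contains (l : letter) (d : direction) : bool :=
  match l, d with
  | La, (Right | Down) => true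
  | Lb, (Up | Down) => true
  | Lc, (Up | Right) => true
  | Ld, (Left | Down) => true
  | Le, (Left | Right) => true
  | Lf, (Up | Left) => true
  | _, _ => false
  end.

Definition letter_code (l : letter) : nat :=
  match l with La => 0 | Lb => 1 | Lc => 2 | Ld => 3 | Le => 4 | Lf => 5 end.

Definition letter_decode (n : nat) : option letter :=
  match n with
  | 0 => Some La | 1 => Some Lb | 2 => Some Lc
  | 3 => Some Ld | 4 => Some Le | 5 => Some Lf | _ => None
  end.

Lemma letter_codeK : pcancel letter_code letter_decode.
Proof. by case. Qed.

HB.instance Definition _ := Countable.copy letter (pcan_type letter_codeK).

Lemma letter_enumP : Finite.axiom [:: La; Lb; Lc; Ld; Le; Lf].
Proof. by case. Qed.

HB.instance Definition _ := isFinite.Build letter letter_enumP.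

(* Words are read from top to bottom; the index i : 'I_m is position i.+1. *)
Definition alpha_word (m : nat) (w : m.-tuple letter) : bool :=
  [&& [forall i : 'I_m, (i == 0 :> nat) ==> ~~ contains (tnth w i) Up],
      [forall i : 'I_m, (i.+1 == m) ==> ~~ contains (tnth w i) Down] &
      [forall i : 'I_m, forall j : 'I_m, (i.+1 == j) ==>
         (contains (tnth w i) Down == contains (tnth w j) Up)]].

Definition D (m : nat) : digraph (m.-tuple letter) :=
  Digraph
    [set w | alpha_word w]
    [set p | [&& alpha_word p.1, alpha_word p.2 &
       [forall i : 'I_m,
          contains (tnth p.1 i) Right == contains (tnth p.2 i) Left]]].

(* Binary words are boolean tuples, with 1 = true and 0 = false. *)
Definition outlet (m : nat) (w : m.-tuple letter) : m.-tuple bool :=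
  [tuple contains (tnth w i) Right | i < m].

Definition Dstar (m : nat) : digraph (m.-tuple bool) := glue (@outlet m) (D m).

Definition odd_zeros (m : nat) (x : m.-tuple bool) : nat :=
  #|[set i : 'I_m | odd i.+1 & ~~ tnth x i]|.

Definition even_zeros (m : nat) (x : m.-tuple bool) : nat :=
  #|[set i : 'I_m | ~~ odd i.+1 & ~~ tnth x i]|.

Definition Z (m : nat) (x : m.-tuple bool) : int :=
  ((odd_zeros x)%:Z - (even_zeros x)%:Z)%R.

Definition Rset (m s : nat) : {set m.-tuple bool} :=
  [set x | Z x == s%:Z%R].

Definition Gset (m s : nat) : {set m.-tuple bool} :=
  [set x | Z x == (- s%:Z)%R].

Definition Sset (m s : nat) : {set m.-tuple bool} :=
  if s == 0 then [set x | Z x == 0%R] else Rset m s :|: Gset m s.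

(* Main.v *)
(* The vertical edges of a column with left bits v and right bits w are
   determined from top to bottom by v and w, and taking the alternating sum of
   the degree conditions gives Z v + Z w = 0 for every arc; this yields (ii) and
   (iii).  For (i), two words that differ by replacing an adjacent pair 00 by 11
   have a common neighbour: the complement of the word outside that pair, with a
   suitable choice on the pair.  Negating the letters at even positions turns Z
   into a count of ones up to constants and these replacements into adjacent
   transpositions, so they connect all words with the same Z.  Finally every
   vertex has a neighbour, and that neighbour has the opposite value of Z. *)
Require Import Defs.
From HB Require Import structures.
From mathcomp Require Import all_boot all_order all_algebra zify.

Set Implicit Arguments.
Unset Strict Implicit.
Unset Printing Implicit Defensive.

Import Order.TTheory GRing.Theory Num.Theory.

(** * Columns as state transfers, and the alternating sum *)

(* Existence of a column of letters with left bits s and right bits t, where u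
   and v tell whether an edge enters at the top and leaves at the bottom: equal
   bits x leave the vertical state at ~~ x, distinct bits toggle it. *)
Fixpoint transfer (u v : bool) (s t : seq bool) : bool :=
  match s, t with
  | x :: s', y :: t' =>
      if x == y then (u == ~~ x) && transfer u v s' t'
      else transfer (~~ u) v s' t'
  | [::], [::] => u == v
  | _, _ => false
  end.

Lemma transfer_sym u v s t : transfer u v s t = transfer u v t s.
Proof.
elim: s t u => [|x s IHs] [|y t] u //=.
by rewrite !IHs; case: x y => [] [].
Qed.

Lemma size_transfer u v s t : transfer u v s t -> size s = size t.
Proof.
elim: s t u => [|x s IHs] [|y t] u //=.
by case: ifP => _ => [/andP[_]|] /IHs ->.
Qed.

Lemma transfer_cat u v w s1 s2 t1 t2 :
  transfer u v s1 t1 -> transfer v w s2 t2 ->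
  transfer u w (s1 ++ s2) (t1 ++ t2).
Proof.
elim: s1 t1 u => [|x s1 IHs] [|y t1] u //=; first by move/eqP->.
by case: ifP => _ => [/andP[-> /=]|]; apply: IHs.
Qed.

Lemma transfer_negb u s :
  transfer u (u (+) odd (size s)) s (map negb s).
Proof.
elim: s u => [|x s IHs] u /=; first by rewrite addbF.
have /negbTE-> : x != ~~ x by case: x.
by rewrite addbN -addNb.
Qed.

(** This is [Z] computed recursively: dropping the first letter swaps odd and even positions, hence
    the sign. *)
Fixpoint altz (s : seq bool) : int :=
  if s is x :: s' then (Posz (~~ x) - altz s')%R else 0%R.

(** At each position the number of zeros among the two bits equals the sum of the states before and
    after it, so the alternating sum telescopes to the initial state. *)
Lemma transfer_altz u s t : transfer u false s t -> (altz s + altz t)%R = u.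
Proof.
elim: s t u => [|x s IHs] [|y t] u //=; first by case: u.
by case: ifP => H => [/andP[H1]|] /IHs; move: H; try move: H1;
  case: x y u => [] [] [] //= *; lia.
Qed.

Lemma altz_bounds s :
  (- Posz (size s)./2 <= altz s <= Posz (uphalf (size s)))%R.
Proof. by elim: s => //= x s; case: x => /=; lia. Qed.

Fixpoint alternating (x : bool) (n : nat) : seq bool :=
  if n is n'.+1 then x :: alternating (~~ x) n' else [::].

Lemma altz_alternating x n :
  altz (alternating x n) = if x then (- Posz n./2)%R else Posz (uphalf n).
Proof. by elim: n x => [|n IHn] [] //=; rewrite IHn /=; lia. Qed.

(* Complementing s makes the vertical edges alternate.  Wherever the incoming
   state u equals ~~ x, one may copy x instead and keep the state, which changes
   the final state; this fails only if s alternates. *)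
Lemma alternating_or_transfer u s :
  s = alternating u (size s) \/
  exists t, transfer u (~~ (u (+) odd (size s))) s t.
Proof.
elim: s u => [|x s IHs] u /=; first by left.
have [xE|] := eqVneq x u.
  case: (IHs (~~ u)) => [{1}-> | [t st]]; first by left; rewrite xE.
  right; exists (~~ x :: t); have /negbTE-> : x != ~~ x by case: x {xE}.
  by rewrite addbN -addNb.
move=> xu; right; exists (x :: map negb s); rewrite eqxx.
have -> : u == ~~ x by case: x u xu => [] [].
by rewrite addbN negbK transfer_negb.
Qed.

(** For even length the complement works. For odd length the only obstruction is the word 01...10,
    whose [altz] is [uphalf (size s)], one above the bound. *)
Lemma exists_transfer s :
  (altz s <= Posz (size s)./2)%R -> exists t, transfer false false s t.
Proof.
have [odds|evens] := boolP (odd (size s)); last first.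
  by exists (map negb s); have := transfer_negb false s; rewrite (negbTE evens).
case: (alternating_or_transfer false s) => [->|]; last by rewrite odds.
have size_alt x n : size (alternating x n) = n.
  by elim: n x => //= n IHn x; rewrite IHn.
by rewrite altz_alternating size_alt; lia.
Qed.

Lemma pair_common_transfer s1 s2 :
  exists t, forall b, transfer false false (s1 ++ b :: b :: s2) t.
Proof.
pose u := odd (size s1); pose v := odd (size s2).
(* The complemented prefix leads to state [u], and the complemented suffix ends at [false] when
   started from [v]. Opposite [~~ u; ~~ v], both values of [b] lead from [u] to [v]. *)
exists (map negb s1 ++ [:: ~~ u; ~~ v] ++ map negb s2) => b.
apply: (@transfer_cat _ u); first exact: (transfer_negb false).
apply: (@transfer_cat _ v _ [:: b; b]); first by case: u v b => [] [] [].
by have := transfer_negb v s2; rewrite addbb.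
Qed.

(** * Complementing adjacent equal letters *)

Inductive flips : seq bool -> seq bool -> Prop :=
| flips_refl s : flips s s
| flips_trans t s r : flips s t -> flips t r -> flips s r
| flips_pair b s : flips (b :: b :: s) (~~ b :: ~~ b :: s)
| flips_cons x s t : flips s t -> flips (x :: s) (x :: t).

Lemma flips_sym s t : flips s t -> flips t s.
Proof.
elim=> {s t} [s|t s r _ ts _ rt|b s|x s t _ ts].
- exact: flips_refl.
- exact: flips_trans rt ts.
- by rewrite -{3 4}[b]negbK; apply: flips_pair.
- exact: flips_cons.
Qed.

Lemma flips_size s t : flips s t -> size s = size t.
Proof. by elim=> {s t} //= [t s r _ -> _ ->|x s t _ ->]. Qed.

Lemma flips_altz s t : flips s t -> altz s = altz t.
Proof.
by elim=> {s t} //= [t s r _ -> _ ->|[] s|x s t _ ->] //=; lia.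
Qed.

(** If the first letter is [~~ x], bring a second [~~ x] next to it recursively and complement the
    pair; this is blocked only in an alternating word. *)
Lemma flips_head x s :
  s = alternating (~~ x) (size s) \/ exists t, flips s (x :: t).
Proof.
elim: s x => [|y s IHs] x /=; first by left.
have [->|yx] := eqVneq y x; first by right; exists s; apply: flips_refl.
have -> : y = ~~ x by case: y x yx => [] [].
case: (IHs (~~ x)) => [{1}->|[t st]]; first by left.
right; exists (x :: t); apply: flips_trans (flips_cons _ st) _.
by rewrite -{3 4}[x]negbK; apply: flips_pair.
Qed.

(** Make the first letters agree by [flips_head], then recurse on the tails. If neither word can be
    adjusted, both alternate with opposite first letters, and their [altz] differ. *)
Lemma altz_flips s t : size s = size t -> altz s = altz t -> flips s t.
Proof.
have [n] := ubnP (size s); elim: n s t => // n IHn [|x s] [|y t] //.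
  by move=> *; apply: flips_refl.
rewrite ltnS => s_n st_size st_altz.
have tailP z s' t' : size s' = size s -> size t' = size s ->
    altz (z :: s') = altz (z :: t') -> flips (z :: s') (z :: t').
  move=> s'E t'E /= ?; apply/flips_cons/IHn; rewrite ?s'E ?t'E //; lia.
have [xy|xy] := eqVneq x y.
  by subst y; apply: tailP => //; case: st_size.
case: (flips_head y (x :: s)) => [sE|[s' ss']]; last first.
  apply: (flips_trans ss'); apply: tailP.
  - by have [->] := flips_size ss'.
  - by case: st_size.
  - by rewrite -(flips_altz ss').
case: (flips_head x (y :: t)) => [tE|[t' tt']]; last first.
  apply: flips_trans (flips_sym tt'); apply: tailP => //.
  - by have [<-] := flips_size tt'; case: st_size.
  - by rewrite -(flips_altz tt').
move: st_altz; rewrite sE tE !altz_alternating st_size.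
by move: xy; rewrite /=; move: (size t) => k; clear; case: x y => [] [] //= _; lia.
Qed.

(** * Vertices and arcs of [Dstar] through [transfer] *)

Definition alpha_seq (u v : bool) (w : seq letter) : bool :=
  rcons [seq contains l Up | l <- w] v == u :: [seq contains l Down | l <- w].

(** The shift in [alpha_seq] puts the up-bit of each letter opposite the down-bit of the letter
    above, with [false] at both ends, so one equation covers the three conditions. *)
Lemma alpha_wordE m (w : m.-tuple letter) :
  alpha_word w = alpha_seq false false w.
Proof.
have upE i (lim : i < m) : contains (tnth w (Ordinal lim)) Up =
    nth false (rcons [seq contains l Up | l <- w] false) i.
  by rewrite nth_rcons size_map size_tuple lim (nth_map La) ?size_tuple // (tnth_nth La).
have downE i (lim : i < m) : contains (tnth w (Ordinal lim)) Down =
    nth false (false :: [seq contains l Down | l <- w]) i.+1.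
  by rewrite /= (nth_map La) ?size_tuple // (tnth_nth La).
have lastE : nth false (rcons [seq contains l Up | l <- w] false) m = false.
  by rewrite nth_rcons size_map size_tuple ltnn eqxx.
apply/idP/eqP => [/and3P[/forallP topP /forallP botP /forallP midP] | wE].
  apply: (@eq_from_nth _ false); first by rewrite size_rcons /= !size_map.
  case=> [|i]; rewrite size_rcons size_map size_tuple ltnS => lim.
    case: m w upE downE lastE topP botP midP {lim} => [|m] w upE _ lastE topP _ _.
      exact: lastE.
    by rewrite -(upE 0 isT) /=; have := topP (Ordinal (isT : 0 < m.+1)) => /= /negbTE.
  rewrite -(downE i lim).
  have [im|im] := eqVneq i.+1 m.
    by rewrite im lastE; have := botP (Ordinal lim); rewrite /= im eqxx /= => /negbTE.
  have lim' : i.+1 < m by rewrite ltn_neqAle im.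
  rewrite -(upE _ lim').
  by have /forallP/(_ (Ordinal lim')) := midP (Ordinal lim); rewrite eqxx => /eqP.
apply/and3P; split; apply/forallP => -[i lim] /=.
- by apply/implyP => /eqP i0; subst i; rewrite upE wE.
- by apply/implyP => /eqP im; rewrite downE -wE im lastE.
apply/forallP => -[j ljm] /=; apply/implyP => /eqP ij; subst j.
by rewrite upE downE wE.
Qed.

Lemma transferP u v s t :
  reflect (exists w, [/\ alpha_seq u v w, s = [seq contains l Left | l <- w] &
                          t = [seq contains l Right | l <- w]])
          (transfer u v s t).
Proof.
apply: (iffP idP) => [|[w [wP -> ->]] {s t}].
  elim: s t u => [|x s IHs] [|y t] u //=.
    by move=> /eqP->; exists [::]; split; rewrite // /alpha_seq.
  (* The left bit, the right bit and the incoming state determine the letter; for equal bits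
     [transfer] forces the state that [Le] or [Lb] needs. *)
  pose l := if x then (if y then Le else if u then Lf else Ld)
            else (if y then (if u then Lc else La) else Lb).
  move=> H; have {H} [lu /IHs[w [wP -> ->]]] :
      contains l Up = u /\ transfer (contains l Down) v s t.
    by move: H; rewrite /l; case: x y u {l} => [] [] [] //=.
  exists (l :: w); split.
  - by rewrite /alpha_seq /= lu (eqP wP).
  - by rewrite /= /l; case: x y u {l lu wP} => [] [] [].
  - by rewrite /= /l; case: x y u {l lu wP} => [] [] [].
elim: w u wP => [|l w IHw] u; first by rewrite /alpha_seq => /eqP[->] /=.
rewrite /alpha_seq /= => /eqP[<- /eqP/IHw].
by case: l.
Qed.

Lemma val_outlet m (w : m.-tuple letter) :
  outlet w = [seq contains l Right | l <- w] :> seq bool.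
Proof.
apply: (@eq_from_nth _ false); first by rewrite size_map !size_tuple.
move=> i; rewrite size_tuple => lim.
rewrite (nth_map La) ?size_tuple // -(tnth_nth _ _ (Ordinal lim)).
by rewrite -(tnth_nth _ _ (Ordinal lim)) tnth_mktuple.
Qed.

Lemma mem_verts_Dstar m (x : m.-tuple bool) :
  reflect (exists y : m.-tuple bool, transfer false false x y)
          (x \in verts (Dstar m)).
Proof.
apply: (iffP imsetP) => [[w]|[y]].
  rewrite inE alpha_wordE => wP ->.
  exists [tuple of [seq contains l Left | l <- w]].
  by rewrite transfer_sym; apply/transferP; exists w; rewrite val_outlet.
rewrite transfer_sym => /transferP[w [wP _ xE]].
have sw : size w == m by have := congr1 size xE; rewrite size_map size_tuple => ->.
exists (Tuple sw); first by rewrite inE alpha_wordE.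
by apply: val_inj; rewrite /= xE val_outlet.
Qed.

(** The head column alone carries both words, as left and right bits. A tail column with outlet [x]
    comes from mirroring, that is, from [transfer_sym]. *)
Lemma mem_arcs_Dstar m (x y : m.-tuple bool) :
  ((x, y) \in arcs (Dstar m)) = transfer false false x y.
Proof.
apply/imsetP/idP => [[[a b]]|xy].
  rewrite inE /= !alpha_wordE => /and3P[aP bP /forallP abP] [-> ->].
  apply/transferP; exists b; split=> //; last exact: val_outlet.
  rewrite val_outlet; apply: (@eq_from_nth _ false).
    by rewrite !size_map !size_tuple.
  move=> i; rewrite size_map size_tuple => lim.
  rewrite !(nth_map La) ?size_tuple //.
  by have /eqP := abP (Ordinal lim); rewrite !(tnth_nth La).
have /transferP[b [bP xb yb]] := xy.
have /transferP[a [aP _ xa]] : transfer false false y x by rewrite transfer_sym.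
have sb : size b == m by have := congr1 size yb; rewrite size_map size_tuple => ->.
have sa : size a == m by have := congr1 size xa; rewrite size_map size_tuple => ->.
exists (Tuple sa, Tuple sb) => /=; last first.
  by congr pair; apply: val_inj; rewrite /= ?xa ?yb val_outlet.
rewrite inE /= !alpha_wordE aP bP /=; apply/forallP => i.
have := congr1 (nth false ^~ i) (etrans (esym xa) xb).
by rewrite !(tnth_nth La) /= !(nth_map La) ?(eqP sa) ?(eqP sb) // => ->.
Qed.

Lemma Z_altz m (x : m.-tuple bool) : Z x = altz x.
Proof.
have cardE (P : pred 'I_m) : #|[set i | P i]| = \sum_(i < m) P i.
  by rewrite -sum1dep_card big_mkcond; apply: eq_bigr => i _; case: (P i).
rewrite /Z /odd_zeros /even_zeros !cardE {cardE}.
elim: m x => [|m IHm] x; first by rewrite !big_ord0 tuple0.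
case/tupleP: x => b x; rewrite [RHS]/= -IHm !big_ord_recl !tnth0.
have tailE (P : bool -> bool) :
    \sum_(i < m) (P (odd (lift ord0 i).+1) &&
                  ~~ tnth [tuple of b :: x] (lift ord0 i)) =
    \sum_(i < m) (P (~~ odd i.+1) && ~~ tnth x i).
  by apply: eq_bigr => i _; rewrite tnthS.
rewrite (tailE id) (tailE negb).
under [X in (_ - Posz (_ + X))%R = _]eq_bigr do rewrite negbK.
by rewrite add0n; move: (\sum_(_ < _) _) (\sum_(_ < _) _) => p q; case: b {tailE} => /=; lia.
Qed.

Lemma mem_Sset m s (x : m.-tuple bool) : (x \in Sset m s) = (absz (altz x) == s).
Proof. by rewrite /Sset; case: eqP => [->|_]; rewrite !inE Z_altz; lia. Qed.

Lemma arc_altz m (x y : m.-tuple bool) :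
  (x, y) \in arcs (Dstar m) -> altz y = (- altz x)%R.
Proof. by rewrite mem_arcs_Dstar => /transfer_altz /=; lia. Qed.

(** A neighbour has the opposite [altz], so its lower bound [- m./2] bounds [altz x] from above. *)
Lemma verts_DstarE m (x : m.-tuple bool) :
  (x \in verts (Dstar m)) = (absz (altz x) <= m./2).
Proof.
have := altz_bounds x; rewrite size_tuple => xb.
apply/mem_verts_Dstar/idP => [[y xy]|xm].
  have := altz_bounds y; have := transfer_altz xy; rewrite size_tuple /=; lia.
have [|t xt] := @exists_transfer x; first by rewrite size_tuple; lia.
have st : size t == m by rewrite -(size_transfer xt) size_tuple.
by exists (Tuple st).
Qed.

Lemma verts_digraphU (T : finType) I r (F : I -> digraph T) :
  verts (\big[@digraphU T/@digraph0 T]_(i <- r) F i) =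
  \bigcup_(i <- r) verts (F i).
Proof. exact: (big_morph (@verts T)). Qed.

Lemma arcs_digraphU (T : finType) I r (F : I -> digraph T) :
  arcs (\big[@digraphU T/@digraph0 T]_(i <- r) F i) =
  \bigcup_(i <- r) arcs (F i).
Proof. exact: (big_morph (@arcs T)). Qed.

(** * Strong connectivity of the induced subdigraphs *)

Section Connectivity.

Variables m s : nat.

Let e : rel (m.-tuple bool) :=
  [rel u v | (u, v) \in arcs (induced (Dstar m) (Sset m s))].

Lemma induced_arcE x y : e x y = transfer false false x y && (absz (altz x) == s).
Proof.
rewrite /e /= inE /= mem_arcs_Dstar !mem_Sset.
by case xy : (transfer _ _ _ _) => //=; have := transfer_altz xy => /=; lia.
Qed.

Lemma induced_arc_sym : symmetric e.
Proof.
move=> x y; rewrite !induced_arcE [in RHS]transfer_sym.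
by case xy : (transfer _ _ _ _) => //=; have := transfer_altz xy => /=; lia.
Qed.

(** The prefix [c] absorbs the letters peeled off by [flips_cons], so the induction always speaks of
    vertices of full length [m]. *)
Lemma flips_connect c t t' (x y : m.-tuple bool) : flips t t' ->
  x = c ++ t :> seq bool -> y = c ++ t' :> seq bool ->
  absz (altz x) == s -> connect e x y.
Proof.
move=> tt'; elim: tt' c x y => {t t'} [t|t' t t'' tt' IH1 _ IH2|b t|b t t' _ IH] c x y xE yE xs.
- by have -> : x = y by apply: val_inj; rewrite /= xE yE.
- have sz : size (c ++ t') == m.
    by rewrite size_cat -(flips_size tt') -size_cat -xE size_tuple.
  apply: connect_trans (IH1 c x (Tuple sz) xE erefl xs) _.
  apply: (IH2 c) => //=.
  rewrite xE in xs; rewrite -(eqP xs); apply/eqP; congr absz.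
  by elim: c {IH1 IH2 xE yE xs sz} => [|b c IHc] /=; rewrite ?IHc ?(flips_altz tt').
- have [w wP] := pair_common_transfer c t.
  have sw : size w == m by rewrite -(size_transfer (wP b)) -xE size_tuple.
  have xw : e x (Tuple sw) by rewrite induced_arcE /= xE wP -xE.
  apply: connect_trans (connect1 xw) _.
  apply: connect1; rewrite induced_arcE transfer_sym /= yE wP /=.
  by have := transfer_altz (wP b); rewrite -xE /=; lia.
- by apply: (IH (rcons c b)); rewrite ?cat_rcons.
Qed.

Lemma same_altz_connect (x y : m.-tuple bool) :
  absz (altz x) == s -> altz x = altz y -> connect e x y.
Proof.
move=> xs xy; apply: (@flips_connect [::] x y) => //.
by apply: altz_flips; rewrite ?size_tuple.
Qed.

Lemma induced_strongly_connected :
  s <= m./2 -> strongly_connected (induced (Dstar m) (Sset m s)).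
Proof.
move=> sm x y; rewrite /= !mem_Sset => xs ys.
have absz_eq (a b : int) : absz a == s -> absz b == s -> a = b \/ (- a)%R = b by lia.
have [xy|xy] := absz_eq _ _ xs ys; first exact: same_altz_connect.
have /mem_verts_Dstar[w xw] : x \in verts (Dstar m).
  by rewrite verts_DstarE (eqP xs).
have exw : e x w by rewrite induced_arcE xw.
apply: connect_trans (connect1 exw) _.
have wx : altz w = (- altz x)%R by apply: arc_altz; rewrite mem_arcs_Dstar.
by apply: same_altz_connect; rewrite wx // abszN.
Qed.

End Connectivity.

Theorem lemma2 (m : nat) (hm : 2 <= m) :
  [/\ forall s : nat, s <= m./2 ->
        strongly_connected (induced (Dstar m) (Sset m s)),
      forall s : nat, 1 <= s <= m./2 ->
        bipartite_with (induced (Dstar m) (Sset m s)) (Rset m s) (Gset m s) &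
      (forall s t : nat, s < t <= m./2 ->
         forall x y : m.-tuple bool, x \in Sset m s -> y \in Sset m t ->
           (x, y) \notin arcs (Dstar m) /\ (y, x) \notin arcs (Dstar m)) /\
      Dstar m =
        \big[@digraphU _ / @digraph0 _]_(s < (m./2).+1)
           induced (Dstar m) (Sset m s)].
Proof.
split.
- by move=> s; apply: induced_strongly_connected.
- move=> s /andP[s_gt0 _]; split.
  + by rewrite /= /Sset; case: s s_gt0.
  + by apply/pred0P => x /=; rewrite !inE; lia.
  + move=> x y; rewrite inE => /andP[/arc_altz xy _].
    by rewrite !inE !Z_altz xy; lia.
split=> [s t /andP[st _] x y|].
  rewrite !mem_Sset => xs yt.
  by split; apply/negP => /arc_altz; lia.
(* Exposing the constructor on both sides splits the equality into vertices and arcs; the component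
   of [x] has index [absz (altz x)]. *)
rewrite [LHS](_ : _ = Digraph (verts (Dstar m)) (arcs (Dstar m))) //.
rewrite [RHS](_ : _ = Digraph (verts (\big[@digraphU _/@digraph0 _]_(s < (m./2).+1)
   induced (Dstar m) (Sset m s))) (arcs (\big[@digraphU _/@digraph0 _]_(s < (m./2).+1)
   induced (Dstar m) (Sset m s)))); last by case: (\big[_/_]_(_ < _) _).
rewrite verts_digraphU arcs_digraphU; congr Digraph.
  apply/setP => x; rewrite verts_DstarE.
  apply/idP/bigcupP => [xm|[i _]]; last first.
    by rewrite mem_Sset => /eqP->; rewrite -ltnS.
  by exists (Ordinal (xm : absz (altz x) < (m./2).+1)); rewrite //= mem_Sset.
apply/setP => -[x y]; apply/idP/bigcupP => [xy|[i _]]; last by rewrite inE => /andP[].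
have xm : absz (altz x) <= m./2.
  by rewrite -verts_DstarE; apply/mem_verts_Dstar; exists y; rewrite -mem_arcs_Dstar.
exists (Ordinal (xm : absz (altz x) < (m./2).+1)); rewrite //= inE xy /= !mem_Sset eqxx.
by rewrite (arc_altz xy); lia.
Qed.
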